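(* Let $\alpha=(\alpha_1,\dots,\alpha_n)\in\mathbb{R}^n$ with $\alpha_1,\dots,\alpha_n,1$ linearly independent over $\mathbb{Q}$. Then the linear form $L_\alpha$ is badly approximable if and only if there is $\delta>0$ with $|\alpha_{k,1}|\ge\delta$ for all $k\ge1$.
   Context: $L_\alpha(x)=\alpha_1x_1+\cdots+\alpha_nx_n$. For $t\in\mathbb{R}$, $\|t\|$ is the distance from $t$ to the nearest integer. $L_\alpha$ is badly approximable if there is $c>0$ with $\|L_\alpha(q)\|\ge c\|q\|_\infty^{-n}$ for all nonzero $q\in\mathbb{Z}^n$, where $\|\cdot\|_\infty$ is the maximum of absolute values of coordinates. Minkowski chain: let $\ell=n+1$; for $r=(r_1,\dots,r_\ell)\in\mathbb{Z}^\ell$ put $\xi(r)=r_1\alpha_1+\cdots+r_n\alpha_n+r_\ell$. For a real matrix, $\|\cdot\|_\infty$ is the maximum absolute value of its entries. For $m\in\mathbb{Z}^+$, $A_m$ is the nonsingular integral $\ell\times\ell$ matrix with rows $w_1,\dots,w_\ell$ chosen successively: $w_i$ is the vector $w\in\mathbb{Z}^\ell$ with $\|w\|_\infty\le m$, linearly independent of $w_1,\dots,w_{i-1}$, minimizing $|\xi(w)|$, normalized so that its first nonzero entry is positive (unique by the linear independence hypothesis). The Minkowski chain $B_1,B_2,\dots$ is the sequence of distinct matrices among $A_1,A_2,\dots$ in order of appearance. For $B_k$ let $(\beta_1,\dots,\beta_\ell)^\top=B_k(\alpha_1,\dots,\alpha_n,1)^\top$ and define $\alpha_{k,i}=\beta_i/\beta_\ell$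 for $i=1,\dots,n$ (equivalently $(\alpha_{k,1},\dots,\alpha_{k,n})$ is the image of $(\alpha_1,\dots,\alpha_n)$ under $B_k$ acting as a linear fractional map). *)

(* Defs.v *)
From Stdlib Require Import Reals ZArith QArith Qreals Arith.
Open Scope R_scope.

(* Indexing conventions (0-based):
   alpha : nat -> R, alpha i = alpha_{i+1} for i < n.
   Integer vectors in Z^l (l = n+1) are functions nat -> Z read at indices < l.
   An l x l integral matrix W : nat -> nat -> Z, entry (i,j) = W i j, i,j < l. *)

Fixpoint sumR (f : nat -> R) (k : nat) : R :=
  match k with O => 0 | S k' => sumR f k' + f k' end.

Fixpoint sumQ (f : nat -> Q) (k : nat) : Q :=
  match k with O => 0%Q | S k' => (sumQ f k' + f k')%Q end.

Fixpoint supnormZ (q : nat -> Z) (k : nat) : Z :=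
  match k with O => 0%Z | S k' => Z.max (supnormZ q k') (Z.abs (q k')) end.

(* ||t|| : distance from t to the nearest integer; floor t = up t - 1 *)
Definition dist_Z (t : R) : R :=
  Rmin (t - IZR (up t - 1)) (IZR (up t) - t).

Definition Q_lin_indep_with_1 (n : nat) (alpha : nat -> R) : Prop :=
  forall c : nat -> Q,
    sumR (fun i => Q2R (c i) * alpha i) n + Q2R (c n) = 0 ->
    forall i, (i <= n)%nat -> (c i == 0)%Q.

Definition L_form (n : nat) (alpha : nat -> R) (q : nat -> Z) : R :=
  sumR (fun i => IZR (q i) * alpha i) n.

Definition badly_approximable (n : nat) (alpha : nat -> R) : Prop :=
  exists c : R, 0 < c /\
    forall q : nat -> Z, (exists i, (i < n)%nat /\ q i <> 0%Z) ->
      dist_Z (L_form n alpha q) >= c / (IZR (supnormZ q n)) ^ n.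

Definition xi (n : nat) (alpha : nat -> R) (r : nat -> Z) : R :=
  sumR (fun j => IZR (r j) * alpha j) n + IZR (r n).

Definition rows_indep (l k : nat) (rows : nat -> nat -> Z) : Prop :=
  forall c : nat -> Q,
    (forall j, (j < l)%nat -> (sumQ (fun t => c t * inject_Z (rows t j)) k == 0)%Q) ->
    forall t, (t < k)%nat -> (c t == 0)%Q.

Definition indep_of_prev (l i : nat) (W : nat -> nat -> Z) (v : nat -> Z) : Prop :=
  rows_indep l (S i) (fun t => if Nat.eqb t i then v else W t).

Definition bounded_by (l : nat) (m : Z) (v : nat -> Z) : Prop :=
  forall j, (j < l)%nat -> (Z.abs (v j) <= m)%Z.

Definition first_nonzero_pos (l : nat) (v : nat -> Z) : Prop :=
  exists j, (j < l)%nat /\ (forall j', (j' < j)%nat -> v j' = 0%Z) /\ (0 < v j)%Z.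

Definition is_A (n : nat) (alpha : nat -> R) (m : nat) (W : nat -> nat -> Z) : Prop :=
  forall i, (i < S n)%nat ->
    bounded_by (S n) (Z.of_nat m) (W i) /\
    indep_of_prev (S n) i W (W i) /\
    first_nonzero_pos (S n) (W i) /\
    (forall v, bounded_by (S n) (Z.of_nat m) v -> indep_of_prev (S n) i W v ->
       Rabs (xi n alpha (W i)) <= Rabs (xi n alpha v)).

Definition mx_eq (l : nat) (W W' : nat -> nat -> Z) : Prop :=
  forall i j, (i < l)%nat -> (j < l)%nat -> W i j = W' i j.

Definition new_A (n : nat) (alpha : nat -> R) (m : nat) : Prop :=
  (1 <= m)%nat /\
  forall W, is_A n alpha m W ->
  forall m' W', (1 <= m')%nat -> (m' < m)%nat -> is_A n alpha m' W' ->
    ~ mx_eq (S n) W W'.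

(* B k (k = 0,1,2,...) is the Minkowski chain B_1, B_2, ...:
   B k = A_(mk k) where mk enumerates increasingly the indices m at which
   a new matrix appears among A_1, A_2, ... *)
Definition minkowski_chain (n : nat) (alpha : nat -> R) (B : nat -> nat -> nat -> Z) : Prop :=
  exists mk : nat -> nat,
    (forall k, (mk k < mk (S k))%nat) /\
    (forall k, is_A n alpha (mk k) (B k)) /\
    (forall m, new_A n alpha m <-> exists k, m = mk k).

Definition ext_alpha (n : nat) (alpha : nat -> R) (j : nat) : R :=
  if Nat.ltb j n then alpha j else 1.

Definition beta (n : nat) (alpha : nat -> R) (M : nat -> nat -> Z) (i : nat) : R :=
  sumR (fun j => IZR (M i j) * ext_alpha n alpha j) (S n).

Definition alpha_k1 (n : nat) (alpha : nat -> R) (M : nat -> nat -> Z) : R :=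
  beta n alpha M 0 / beta n alpha M n.

(* Main.v *)
(* Write W for the matrix A_m.  Two estimates, both pigeonhole arguments, suffice.

   Always |xi(w_l)| >> m^(-n): by Siegel's lemma some nonzero integer
   combination z of the rows, with coefficients << m^n, vanishes in its first n
   coordinates.  If |xi(w_l)| were too small, the integer z_l = xi(z) would be
   less than 1 in absolute value, so z = 0, against the independence of the rows.
   Hence |alpha_{k,1}| >= delta forces |xi(w_1)| >> m^(-n).

   If L_alpha is badly approximable then |xi(w_l)| << m^(-n): every integer vector
   in the box with |xi| < |xi(w_l)| lies in the hyperplane spanned by
   w_1, ..., w_{l-1}, and a Dirichlet argument inside that hyperplane gains one
   dimension, producing a vector that approximates too well.

   Every A_m occurs in the chain: if A_m did not exist, [new_A] would hold
   vacuously at m, so that m would be one of the indices of the chain after all. *)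
Require Import Defs.
From Stdlib Require Import Reals ZArith QArith Qreals Arith.
From Stdlib Require Import Lia Lra List Classical.
Open Scope R_scope.

(** * Pigeonhole principle on boxes of digit vectors *)

Lemma pigeonhole_nat (M N : nat) (f : nat -> nat) :
  (forall i, (i < N)%nat -> (f i < M)%nat) -> (M < N)%nat ->
  exists i j, (i < N)%nat /\ (j < N)%nat /\ i <> j /\ f i = f j.
Proof.
  intros Hf HMN. apply NNPP; intro Hno.
  assert (HND : NoDup (map f (seq 0 N))).
  { apply NoDup_map_NoDup_ForallPairs; [|apply seq_NoDup].
    intros i j Hi Hj Hij. apply in_seq in Hi, Hj.
    apply NNPP; intro Hne. apply Hno.
    exists i, j. repeat split; auto; lia. }
  assert (Hincl : incl (map f (seq 0 N)) (seq 0 M)).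
  { intros y Hy. apply in_map_iff in Hy. destruct Hy as [x [<- Hx]].
    apply in_seq in Hx. apply in_seq. specialize (Hf x). lia. }
  pose proof (NoDup_incl_length HND Hincl) as Hlen.
  rewrite length_map, !length_seq in Hlen. lia.
Qed.

Lemma digits_inj (a k x y : nat) :
  (x < a ^ k)%nat -> (y < a ^ k)%nat ->
  (forall i, (i < k)%nat -> ((x / a ^ i) mod a = (y / a ^ i) mod a)%nat) ->
  x = y.
Proof.
  revert x y; induction k as [|k IH]; intros x y Hx Hy Hd.
  - simpl in *. lia.
  - destruct (Nat.eq_dec a 0) as [->|Ha]; [simpl in Hx; lia|].
    simpl in Hx, Hy.
    rewrite (Nat.div_mod_eq x a), (Nat.div_mod_eq y a).
    pose proof (Hd 0%nat ltac:(lia)) as H0.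
    rewrite Nat.pow_0_r, !Nat.div_1_r in H0. rewrite H0. f_equal. f_equal.
    apply IH.
    + apply Nat.Div0.div_lt_upper_bound; lia.
    + apply Nat.Div0.div_lt_upper_bound; lia.
    + intros i Hi. specialize (Hd (S i) ltac:(lia)). simpl in Hd.
      rewrite !Nat.Div0.div_div. exact Hd.
Qed.

(** Packs a tuple of values into one number, so that [pigeonhole_nat] applies to it: the digits
    [F j] are meant to lie below [d], and [g] is a leading digit with a range of its own. *)
Fixpoint mixed_radix (d : nat) (F : nat -> nat) (g k : nat) : nat :=
  match k with O => g | S k' => F k' + d * mixed_radix d F g k' end.

Lemma mixed_radix_lt (d : nat) (F : nat -> nat) (g e k : nat) :
  (g < e)%nat -> (forall j, (j < k)%nat -> (F j < d)%nat) ->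
  (mixed_radix d F g k < d ^ k * e)%nat.
Proof.
  intros Hg; induction k as [|k IH]; intros HF; simpl; [lia|].
  pose proof (HF k ltac:(lia)). specialize (IH (fun j Hj => HF j ltac:(lia))).
  apply Nat.lt_le_trans with (d * S (mixed_radix d F g k))%nat; [lia|].
  rewrite <- Nat.mul_assoc. apply Nat.mul_le_mono_l. lia.
Qed.

Lemma mixed_radix_inj (d : nat) (F F' : nat -> nat) (g g' k : nat) :
  (forall j, (j < k)%nat -> (F j < d)%nat /\ (F' j < d)%nat) ->
  mixed_radix d F g k = mixed_radix d F' g' k ->
  (forall j, (j < k)%nat -> F j = F' j) /\ g = g'.
Proof.
  induction k as [|k IH]; simpl; intros HF Heq; [split; [lia|auto]|].
  destruct (HF k ltac:(lia)) as [H1 H2].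
  assert (Hq : mixed_radix d F g k = mixed_radix d F' g' k /\ F k = F' k)
    by (apply (Nat.div_mod_unique d); lia).
  destruct Hq as [Hq Hk].
  destruct (IH (fun j Hj => HF j ltac:(lia)) Hq) as [IH1 IH2].
  split; [|exact IH2].
  intros j Hj. destruct (Nat.eq_dec j k) as [->|]; [exact Hk|apply IH1; lia].
Qed.

(** The box is parametrized by the base-[a] digits of the numbers below [a ^ k], and the values of
    [F] and [G] are packed into a number below [d ^ k' * e]. Two distinct numbers that collide have
    digits differing at some place below [k], by [digits_inj]. *)
Lemma pigeonhole_box (a k d k' e : nat)
    (F : (nat -> nat) -> nat -> nat) (G : (nat -> nat) -> nat) :
  (1 <= a)%nat ->
  (forall x, (forall i, (x i < a)%nat) ->
    (forall j, (j < k')%nat -> (F x j < d)%nat) /\ (G x < e)%nat) ->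
  (d ^ k' * e < a ^ k)%nat ->
  exists x y, (forall i, (x i < a)%nat) /\ (forall i, (y i < a)%nat) /\
    (exists i, (i < k)%nat /\ x i <> y i) /\
    (forall j, (j < k')%nat -> F x j = F y j) /\ G x = G y.
Proof.
  intros Ha HF Hlt.
  set (dig := fun c i => ((c / a ^ i) mod a)%nat).
  assert (Hdig : forall c i, (dig c i < a)%nat).
  { intros c i. apply Nat.mod_upper_bound. lia. }
  destruct (pigeonhole_nat (d ^ k' * e) (a ^ k)
    (fun c => mixed_radix d (F (dig c)) (G (dig c)) k')) as (c & c' & Hc & Hc' & Hne & Heq).
  - intros c _. destruct (HF (dig c) (Hdig c)). apply mixed_radix_lt; auto.
  - exact Hlt.
  - exists (dig c), (dig c').
    destruct (HF (dig c) (Hdig c)) as [H1 _], (HF (dig c') (Hdig c')) as [H2 _].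
    destruct (mixed_radix_inj _ _ _ _ _ _ (fun j Hj => conj (H1 j Hj) (H2 j Hj)) Heq).
    repeat split; auto.
    apply NNPP; intro Hno. apply Hne, (digits_inj a k); auto.
    intros i Hi. apply NNPP; intro. apply Hno. exists i. auto.
Qed.

(** * Finite sums over the reals, integers and rationals *)

Lemma sumR_ext (f g : nat -> R) (k : nat) :
  (forall i, (i < k)%nat -> f i = g i) -> sumR f k = sumR g k.
Proof.
  induction k as [|k IH]; intros H; simpl; [reflexivity|].
  rewrite IH by (intros; apply H; lia). rewrite H by lia. reflexivity.
Qed.

Lemma sumR_plus (f g : nat -> R) (k : nat) :
  sumR (fun i => f i + g i) k = sumR f k + sumR g k.
Proof. induction k as [|k IH]; simpl; [|rewrite IH]; ring. Qed.

Lemma sumR_scal (a : R) (f : nat -> R) (k : nat) :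
  sumR (fun i => a * f i) k = a * sumR f k.
Proof. induction k as [|k IH]; simpl; [|rewrite IH]; ring. Qed.

Lemma sumR_zero (f : nat -> R) (k : nat) :
  (forall i, (i < k)%nat -> f i = 0) -> sumR f k = 0.
Proof.
  induction k as [|k IH]; intros H; simpl; [reflexivity|].
  rewrite IH by (intros; apply H; lia). rewrite H by lia. ring.
Qed.

Lemma sumR_exchange (f : nat -> nat -> R) (k l : nat) :
  sumR (fun i => sumR (f i) l) k = sumR (fun j => sumR (fun i => f i j) k) l.
Proof.
  induction k as [|k IH]; simpl.
  - symmetry. apply sumR_zero. reflexivity.
  - rewrite IH, <- sumR_plus. reflexivity.
Qed.

Lemma sumR_le (f g : nat -> R) (k : nat) :
  (forall i, (i < k)%nat -> f i <= g i) -> sumR f k <= sumR g k.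
Proof.
  induction k as [|k IH]; intros H; simpl; [lra|].
  specialize (IH (fun i Hi => H i ltac:(lia))). specialize (H k ltac:(lia)). lra.
Qed.

Lemma sumR_abs_le (f : nat -> R) (k : nat) :
  Rabs (sumR f k) <= sumR (fun i => Rabs (f i)) k.
Proof.
  induction k as [|k IH]; simpl; [rewrite Rabs_R0; lra|].
  pose proof (Rabs_triang (sumR f k) (f k)). lra.
Qed.

Lemma sumR_const (a : R) (k : nat) : sumR (fun _ => a) k = INR k * a.
Proof.
  induction k as [|k IH]; [simpl; ring|].
  rewrite S_INR. simpl. rewrite IH. ring.
Qed.

Lemma sumR_nonneg (f : nat -> R) (k : nat) :
  (forall i, (i < k)%nat -> 0 <= f i) -> 0 <= sumR f k.
Proof.
  intros H. apply Rle_trans with (sumR (fun _ => 0) k).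
  - rewrite sumR_const. lra.
  - apply sumR_le; auto.
Qed.

Lemma sumR_single (f : nat -> R) (i k : nat) :
  (i < k)%nat -> sumR f k = f i + sumR (fun j => if Nat.eqb j i then 0 else f j) k.
Proof.
  induction k as [|k IH]; intros H; [lia|]. simpl.
  destruct (Nat.eqb_spec k i) as [->|Hne].
  - rewrite (sumR_ext (fun j => if Nat.eqb j i then 0 else f j) f); [ring|].
    intros j Hj. destruct (Nat.eqb_spec j i); [lia|reflexivity].
  - rewrite IH by lia. ring.
Qed.

Fixpoint sumZ (f : nat -> Z) (k : nat) : Z :=
  match k with O => 0%Z | S k' => (sumZ f k' + f k')%Z end.

Lemma IZR_sumZ (f : nat -> Z) (k : nat) :
  IZR (sumZ f k) = sumR (fun i => IZR (f i)) k.
Proof. induction k as [|k IH]; simpl; [|rewrite plus_IZR, IH]; reflexivity. Qed.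

Lemma sumZ_sub (f g : nat -> Z) (k : nat) :
  sumZ (fun i => f i - g i)%Z k = (sumZ f k - sumZ g k)%Z.
Proof. induction k as [|k IH]; simpl; [|rewrite IH]; ring. Qed.

Lemma sumZ_ext (f g : nat -> Z) (k : nat) :
  (forall i, (i < k)%nat -> f i = g i) -> sumZ f k = sumZ g k.
Proof.
  induction k as [|k IH]; intros H; simpl; [reflexivity|].
  rewrite IH by (intros; apply H; lia). rewrite H by lia. reflexivity.
Qed.

Lemma sumZ_abs_le (f : nat -> Z) (M : Z) (k : nat) :
  (forall i, (i < k)%nat -> (Z.abs (f i) <= M)%Z) ->
  (Z.abs (sumZ f k) <= Z.of_nat k * M)%Z.
Proof.
  induction k as [|k IH]; intros H; simpl sumZ; [simpl; lia|].
  specialize (IH (fun i Hi => H i ltac:(lia))). specialize (H k ltac:(lia)). lia.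
Qed.

Lemma Q2R_sumQ (f : nat -> Q) (k : nat) :
  Q2R (sumQ f k) = sumR (fun i => Q2R (f i)) k.
Proof.
  induction k as [|k IH]; simpl; [apply RMicromega.Q2R_0|].
  rewrite Q2R_plus, IH. reflexivity.
Qed.

Lemma Q2R_inject_Z (z : Z) : Q2R (inject_Z z) = IZR z.
Proof. unfold Q2R, inject_Z; simpl. field. Qed.

Lemma Qeq0_of_Q2R (q : Q) : Q2R q = 0 -> (q == 0)%Q.
Proof. intros H. apply eqR_Qeq. rewrite RMicromega.Q2R_0. exact H. Qed.

Lemma sumQ_ext (f g : nat -> Q) (k : nat) :
  (forall i, (i < k)%nat -> (f i == g i)%Q) -> (sumQ f k == sumQ g k)%Q.
Proof.
  induction k as [|k IH]; intros H; simpl; [reflexivity|].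
  rewrite IH by (intros; apply H; lia). rewrite H by lia. reflexivity.
Qed.

(** * Siegel's lemma *)

(** On vectors with entries in 0, ..., [C], each of the [n] forms takes values in [-[K], [K]]. Two
    such vectors have the same image, and their difference is the kernel vector. *)
Lemma siegel_kernel_vector (n m : nat) (M : nat -> nat -> Z) :
  (forall t j, (t < n)%nat -> (j < S n)%nat -> (Z.abs (M t j) <= Z.of_nat m)%Z) ->
  exists b : nat -> Z,
    (exists j, (j < S n)%nat /\ b j <> 0%Z) /\
    (forall j, (Z.abs (b j) <= Z.of_nat ((2 * S n * m + 1) ^ n))%Z) /\
    (forall t, (t < n)%nat -> sumZ (fun j => M t j * b j)%Z (S n) = 0%Z).
Proof.
  intros HM. set (C := ((2 * S n * m + 1) ^ n)%nat).
  set (K := (S n * (m * C))%nat).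
  assert (HC : (1 <= C)%nat).
  { unfold C. pose proof (Nat.pow_nonzero (2 * S n * m + 1) n). lia. }
  assert (Hb : forall (x : nat -> nat) t, (forall i, (x i < S C)%nat) -> (t < n)%nat ->
    (Z.abs (sumZ (fun j => M t j * Z.of_nat (x j))%Z (S n)) <= Z.of_nat K)%Z).
  { intros x t Hx Ht. unfold K.
    rewrite !Nat2Z.inj_mul. apply sumZ_abs_le. intros i Hi.
    rewrite Z.abs_mul. specialize (HM t i Ht Hi). specialize (Hx i).
    apply Z.mul_le_mono_nonneg; lia. }
  destruct (pigeonhole_box (S C) (S n) (2 * K + 1) n 1
    (fun x t => Z.to_nat (sumZ (fun j => M t j * Z.of_nat (x j)) (S n) + Z.of_nat K)%Z)
    (fun _ => 0%nat)) as (x & y & Hx & Hy & (i & Hi & Hne) & HF & _).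
  - lia.
  - intros x Hx. split; [|lia]. intros t Ht. specialize (Hb x t Hx Ht). lia.
  - rewrite Nat.mul_1_r.
    (* The value of [C] is chosen for this count: [2 * K + 1] is at most [(2 * S n * m + 1) * C],
       whose [n]-th power is [C * C ^ n], less than the number [S C ^ S n] of vectors. *)
    apply Nat.le_lt_trans with (((2 * S n * m + 1) * C) ^ n)%nat.
    + apply Nat.pow_le_mono_l. unfold K. nia.
    + rewrite Nat.pow_mul_l. fold C.
      change (C ^ S C)%nat with (C * C ^ C)%nat.
      apply Nat.le_lt_trans with (C ^ S n)%nat; [simpl; lia|].
      apply Nat.pow_lt_mono_l; lia.
  - exists (fun j => Z.of_nat (x j) - Z.of_nat (y j))%Z. repeat split.
    + exists i. split; [exact Hi|lia].
    + intros j. specialize (Hx j). specialize (Hy j). lia.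
    + intros t Ht. specialize (HF t Ht). simpl in HF.
      rewrite (sumZ_ext _ (fun j => M t j * Z.of_nat (x j) - M t j * Z.of_nat (y j))%Z)
        by (intros; ring).
      rewrite sumZ_sub.
      pose proof (Hb x t Hx Ht) as H1. pose proof (Hb y t Hy Ht) as H2.
      simpl sumZ in *. lia.
Qed.

(** * The sup norm and the linear form [xi] *)

Lemma supnormZ_ge (q : nat -> Z) (k i : nat) :
  (i < k)%nat -> (Z.abs (q i) <= supnormZ q k)%Z.
Proof.
  induction k as [|k IH]; intros H; simpl; [lia|].
  destruct (Nat.eq_dec i k) as [->|]; [lia|]. specialize (IH ltac:(lia)). lia.
Qed.

Lemma supnormZ_ge_1 (q : nat -> Z) (k i : nat) :
  (i < k)%nat -> q i <> 0%Z -> (1 <= supnormZ q k)%Z.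
Proof. intros Hi Hq. pose proof (supnormZ_ge q k i Hi). lia. Qed.

Lemma supnormZ_leR (q : nat -> Z) (k : nat) (M : R) :
  0 <= M -> (forall i, (i < k)%nat -> Rabs (IZR (q i)) <= M) ->
  IZR (supnormZ q k) <= M.
Proof.
  intros HM; induction k as [|k IH]; intros H; simpl; [exact HM|].
  destruct (Z.max_spec (supnormZ q k) (Z.abs (q k))) as [[_ ->]|[_ ->]].
  - rewrite abs_IZR. apply H. lia.
  - apply IH. intros i Hi. apply H. lia.
Qed.

Lemma xi_sub (n : nat) (alpha : nat -> R) (v w : nat -> Z) :
  xi n alpha (fun j => v j - w j)%Z = xi n alpha v - xi n alpha w.
Proof.
  unfold xi. rewrite minus_IZR.
  rewrite (sumR_ext _ (fun j => IZR (v j) * alpha j + (-1) * (IZR (w j) * alpha j)))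
    by (intros; rewrite minus_IZR; ring).
  rewrite sumR_plus, sumR_scal. ring.
Qed.

Lemma xi_add (n : nat) (alpha : nat -> R) (v w : nat -> Z) :
  xi n alpha (fun j => v j + w j)%Z = xi n alpha v + xi n alpha w.
Proof.
  unfold xi. rewrite plus_IZR.
  rewrite (sumR_ext _ (fun j => IZR (v j) * alpha j + IZR (w j) * alpha j))
    by (intros; rewrite plus_IZR; ring).
  rewrite sumR_plus. ring.
Qed.

Lemma xi_comb (n l : nat) (alpha : nat -> R) (b : nat -> Z) (W : nat -> nat -> Z) :
  xi n alpha (fun j => sumZ (fun t => W t j * b t)%Z l) =
  sumR (fun t => IZR (b t) * xi n alpha (W t)) l.
Proof.
  induction l as [|l IH].
  - unfold xi; simpl. rewrite sumR_zero; [ring|intros; ring].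
  - simpl. rewrite xi_add, IH. f_equal. unfold xi. rewrite mult_IZR.
    rewrite (sumR_ext _ (fun j => IZR (b l) * (IZR (W l j) * alpha j)))
      by (intros; rewrite mult_IZR; ring).
    rewrite sumR_scal. ring.
Qed.

Lemma xi_abs_le (n : nat) (alpha : nat -> R) (v : nat -> Z) (M : R) :
  (forall j, (j < S n)%nat -> Rabs (IZR (v j)) <= M) ->
  Rabs (xi n alpha v) <= M * (sumR (fun j => Rabs (alpha j)) n + 1).
Proof.
  intros H. unfold xi. eapply Rle_trans; [apply Rabs_triang|].
  pose proof (H n ltac:(lia)).
  assert (Rabs (sumR (fun j => IZR (v j) * alpha j) n) <=
          M * sumR (fun j => Rabs (alpha j)) n); [|lra].
  eapply Rle_trans; [apply sumR_abs_le|]. rewrite <- sumR_scal.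
  apply sumR_le. intros j Hj. rewrite Rabs_mult.
  apply Rmult_le_compat_r; [apply Rabs_pos|]. apply H. lia.
Qed.

Lemma xi_eq0 (n : nat) (alpha : nat -> R) (v : nat -> Z) :
  Q_lin_indep_with_1 n alpha -> xi n alpha v = 0 ->
  forall j, (j < S n)%nat -> v j = 0%Z.
Proof.
  intros HQ H j Hj.
  assert (Hc : (inject_Z (v j) == 0)%Q).
  { apply (HQ (fun j => inject_Z (v j))); [|lia].
    rewrite Q2R_inject_Z, <- H. unfold xi. f_equal.
    apply sumR_ext. intros i _. rewrite Q2R_inject_Z. reflexivity. }
  unfold Qeq in Hc; simpl in Hc. lia.
Qed.

(** * Linear independence of rows *)

Lemma rows_indep_ext (l k : nat) (rows rows' : nat -> nat -> Z) :
  (forall t j, (t < k)%nat -> (j < l)%nat -> rows t j = rows' t j) ->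
  rows_indep l k rows -> rows_indep l k rows'.
Proof.
  intros He H c Hc. apply H. intros j Hj. eapply Qeq_trans; [|exact (Hc j Hj)].
  apply sumQ_ext. intros t Ht. rewrite He by assumption. reflexivity.
Qed.

Lemma rows_indep_pred (l k : nat) (rows : nat -> nat -> Z) :
  rows_indep l (S k) rows -> rows_indep l k rows.
Proof.
  intros H c Hc.
  assert (Hc' : forall t, (t < S k)%nat -> ((if Nat.ltb t k then c t else 0) == 0)%Q).
  { apply H. intros j Hj. simpl. rewrite Nat.ltb_irrefl.
    eapply Qeq_trans; [|exact (Hc j Hj)]. rewrite Qmult_0_l, Qplus_0_r.
    apply sumQ_ext. intros t Ht. apply Nat.ltb_lt in Ht. rewrite Ht. reflexivity. }
  intros t Ht. specialize (Hc' t ltac:(lia)).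
  apply Nat.ltb_lt in Ht. rewrite Ht in Hc'. exact Hc'.
Qed.

Lemma indep_of_prev_row (l i : nat) (W : nat -> nat -> Z) :
  indep_of_prev l i W (W i) -> rows_indep l (S i) W.
Proof.
  apply rows_indep_ext. intros t j _ _. destruct (Nat.eqb_spec t i); congruence.
Qed.

(** A relation between [v] and the rows before [i] is also one that involves row [i] with
    coefficient 0. The list [c'] inserts this 0 and moves the coefficient of [v] one slot up. *)
Lemma indep_of_prev_shift (l i : nat) (W : nat -> nat -> Z) (v : nat -> Z) :
  indep_of_prev l (S i) W v -> indep_of_prev l i W v.
Proof.
  intros H c Hc.
  set (c' := fun t => if Nat.ltb t i then c t else if Nat.eqb t i then 0%Q else c i).
  assert (Hc' : forall t, (t < S (S i))%nat -> (c' t == 0)%Q).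
  { apply H. intros j Hj. eapply Qeq_trans; [|exact (Hc j Hj)]. simpl.
    rewrite (proj2 (Nat.eqb_neq i (S i))) by lia. rewrite !Nat.eqb_refl.
    assert (Ei : c' i = 0%Q).
    { unfold c'. rewrite Nat.ltb_irrefl, Nat.eqb_refl. reflexivity. }
    assert (ESi : c' (S i) = c i).
    { unfold c'. rewrite (proj2 (Nat.ltb_ge (S i) i)) by lia.
      rewrite (proj2 (Nat.eqb_neq (S i) i)) by lia. reflexivity. }
    rewrite Ei, ESi, Qmult_0_l, Qplus_0_r.
    apply Qplus_comp; [|reflexivity].
    apply sumQ_ext. intros t Ht. unfold c'.
    rewrite (proj2 (Nat.ltb_lt t i)) by lia.
    rewrite (proj2 (Nat.eqb_neq t i)) by lia.
    rewrite (proj2 (Nat.eqb_neq t (S i))) by lia. reflexivity. }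
  intros t Ht. destruct (Nat.eq_dec t i) as [->|Hne].
  - specialize (Hc' (S i) ltac:(lia)). unfold c' in Hc'.
    rewrite (proj2 (Nat.ltb_ge (S i) i)) in Hc' by lia.
    rewrite (proj2 (Nat.eqb_neq (S i) i)) in Hc' by lia. exact Hc'.
  - specialize (Hc' t ltac:(lia)). unfold c' in Hc'.
    rewrite (proj2 (Nat.ltb_lt t i)) in Hc' by lia. exact Hc'.
Qed.

Lemma indep_of_prev_0 (l j : nat) (W : nat -> nat -> Z) (v : nat -> Z) :
  (j < l)%nat -> v j <> 0%Z -> indep_of_prev l 0 W v.
Proof.
  intros Hj Hv c Hc t Ht. assert (t = 0%nat) as -> by lia.
  specialize (Hc j Hj). simpl in Hc. rewrite Qplus_0_l in Hc.
  apply Qmult_integral in Hc. destruct Hc as [Hc|Hc]; [exact Hc|].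
  unfold Qeq in Hc; simpl in Hc. lia.
Qed.

(** Apply the functional [b] to a linear relation: the rows of [W] drop out, so the coefficient of
    [z] is 0, and what remains is a relation among independent rows. This serves to force short
    vectors into the hyperplane with normal [b]. *)
Lemma indep_of_prev_functional (l k : nat) (W : nat -> nat -> Z) (b z : nat -> Z) :
  rows_indep l k W ->
  (forall t, (t < k)%nat -> sumZ (fun j => W t j * b j)%Z l = 0%Z) ->
  sumZ (fun j => z j * b j)%Z l <> 0%Z ->
  indep_of_prev l k W z.
Proof.
  intros HW Hb Hz c Hc.
  assert (Hck : (c k == 0)%Q).
  { apply Qeq0_of_Q2R.
    set (row := fun t => if Nat.eqb t k then z else W t).
    assert (H0 : sumR (fun t => Q2R (c t) * IZR (sumZ (fun j => row t j * b j)%Z l)) (S k) = 0).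
    { rewrite (sumR_ext _ (fun t => sumR (fun j => IZR (b j) * (Q2R (c t) * IZR (row t j))) l)).
      2:{ intros t _. rewrite IZR_sumZ, <- sumR_scal. apply sumR_ext.
          intros j _. rewrite mult_IZR. ring. }
      rewrite sumR_exchange. apply sumR_zero. intros j Hj. rewrite sumR_scal.
      specialize (Hc j Hj). apply Qeq_eqR in Hc.
      rewrite Q2R_sumQ, RMicromega.Q2R_0 in Hc.
      rewrite (sumR_ext _ (fun t => Q2R (c t * inject_Z (row t j)))).
      - unfold row. rewrite Hc. ring.
      - intros t _. rewrite Q2R_mult, Q2R_inject_Z. reflexivity. }
    simpl in H0. rewrite sumR_zero in H0.
    2:{ intros t Ht. unfold row. rewrite (proj2 (Nat.eqb_neq t k)) by lia.
        rewrite Hb by assumption. ring. }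
    unfold row in H0. rewrite Nat.eqb_refl in H0.
    rewrite Rplus_0_l in H0. apply Rmult_integral in H0.
    destruct H0 as [H0|H0]; [exact H0|]. apply eq_IZR in H0. contradiction. }
  intros t Ht. destruct (Nat.eq_dec t k) as [->|Hne]; [exact Hck|].
  apply HW; [|lia]. intros j Hj. eapply Qeq_trans; [|exact (Hc j Hj)]. simpl.
  rewrite Hck, Qmult_0_l, Qplus_0_r. apply sumQ_ext. intros s Hs.
  rewrite (proj2 (Nat.eqb_neq s k)) by lia. reflexivity.
Qed.

(** * The matrices [A_m]: order of the minima, uniqueness, and their place in the chain *)

Lemma is_A_rows_indep (n m : nat) (alpha : nat -> R) (W : nat -> nat -> Z) :
  is_A n alpha m W -> rows_indep (S n) (S n) W.
Proof. intros H. apply indep_of_prev_row, H. lia. Qed.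

(** The last row is a competitor in the choice of every row [i]: being independent of all rows
    before it, it is independent of the first [i]. *)
Lemma is_A_xi_le_last (n m : nat) (alpha : nat -> R) (W : nat -> nat -> Z) (i : nat) :
  is_A n alpha m W -> (i <= n)%nat ->
  Rabs (xi n alpha (W i)) <= Rabs (xi n alpha (W n)).
Proof.
  intros H Hi. destruct (H n ltac:(lia)) as (Hb & Hind & _ & _).
  destruct (H i ltac:(lia)) as (_ & _ & _ & Hmin).
  apply Hmin; [exact Hb|].
  assert (Hk : forall k, (k <= n)%nat -> indep_of_prev (S n) (n - k) W (W n)).
  { induction k as [|k IH]; intros Hk; [rewrite Nat.sub_0_r; exact Hind|].
    apply indep_of_prev_shift. replace (S (n - S k)) with (n - k)%nat by lia.
    apply IH. lia. }
  specialize (Hk (n - i)%nat ltac:(lia)).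
  replace (n - (n - i))%nat with i in Hk by lia. exact Hk.
Qed.

(** At the smaller of the two leading positions one entry is positive and the other is
    nonnegative. *)
Lemma first_nonzero_pos_opp (l : nat) (v w : nat -> Z) :
  first_nonzero_pos l v -> first_nonzero_pos l w ->
  ~ (forall j, (j < l)%nat -> (v j + w j = 0)%Z).
Proof.
  intros (j & Hj & Hj0 & Hjp) (i & Hi & Hi0 & Hip) H.
  destruct (lt_eq_lt_dec i j) as [[Hlt|Heq]|Hlt].
  - specialize (Hj0 i Hlt). specialize (H i Hi). lia.
  - subst. specialize (H j Hj). lia.
  - specialize (Hi0 j Hlt). specialize (H j Hj). lia.
Qed.

(** Once the earlier rows agree, both [i]-th rows solve the same minimization problem, so their
    values of [xi] agree up to sign. By rational independence the rows themselves agree up to sign,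
    and the normalization excludes the minus sign. *)
Lemma is_A_unique (n m : nat) (alpha : nat -> R) (W W' : nat -> nat -> Z) :
  Q_lin_indep_with_1 n alpha -> is_A n alpha m W -> is_A n alpha m W' ->
  mx_eq (S n) W W'.
Proof.
  intros HQ HW HW' i. induction i as [i IH] using lt_wf_ind. intros j Hi.
  revert j.
  destruct (HW i Hi) as (Hb & Hind & Hpos & Hmin).
  destruct (HW' i Hi) as (Hb' & Hind' & Hpos' & Hmin').
  assert (Habs : Rabs (xi n alpha (W i)) = Rabs (xi n alpha (W' i))).
  { apply Rle_antisym.
    - apply Hmin; [exact Hb'|]. revert Hind'. apply rows_indep_ext.
      intros t j Ht Hj. destruct (Nat.eqb_spec t i); [reflexivity|].
      symmetry. apply IH; lia.
    - apply Hmin'; [exact Hb|]. revert Hind. apply rows_indep_ext.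
      intros t j Ht Hj. destruct (Nat.eqb_spec t i); [reflexivity|].
      apply IH; lia. }
  assert (He : xi n alpha (W i) = xi n alpha (W' i) \/ xi n alpha (W i) = - xi n alpha (W' i))
    by (revert Habs; unfold Rabs; do 2 destruct Rcase_abs; lra).
  destruct He as [He|He]; intros j Hj.
  - pose proof (xi_eq0 n alpha (fun j => W i j - W' i j)%Z HQ) as H0.
    rewrite xi_sub in H0. specialize (H0 ltac:(lra) j Hj). lia.
  - exfalso. apply (first_nonzero_pos_opp _ _ _ Hpos Hpos').
    apply (xi_eq0 n alpha (fun j => W i j + W' i j)%Z HQ). rewrite xi_add. lra.
Qed.

(** Matrices are functions on all of [nat], but [is_A] reads only the entries inside the square. *)
Lemma is_A_mx_eq (n m : nat) (alpha : nat -> R) (W W' : nat -> nat -> Z) :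
  mx_eq (S n) W W' -> is_A n alpha m W -> is_A n alpha m W'.
Proof.
  intros He HW i Hi. destruct (HW i Hi) as (Hb & Hind & (j & Hj & Hj0 & Hjp) & Hmin).
  assert (Hxi : xi n alpha (W' i) = xi n alpha (W i)).
  { unfold xi. rewrite (He i n) by lia. f_equal. apply sumR_ext.
    intros s Hs. rewrite (He i s) by lia. reflexivity. }
  split; [|split; [|split]].
  - intros s Hs. rewrite <- (He i s Hi Hs). apply Hb, Hs.
  - revert Hind. apply rows_indep_ext. intros t s Ht Hs.
    destruct (Nat.eqb t i); apply He; lia.
  - exists j. split; [exact Hj|]. split.
    + intros s Hs. rewrite <- He by lia. apply Hj0, Hs.
    + rewrite <- He by lia. exact Hjp.
  - intros v Hv Hvi. rewrite Hxi. apply Hmin; [exact Hv|].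
    revert Hvi. apply rows_indep_ext. intros t s Ht Hs.
    destruct (Nat.eqb t i); [reflexivity|]. symmetry. apply He; lia.
Qed.

(** Strong induction on [m]: if [m] is not new, its matrix agrees with that of some smaller [m'],
    hence, by uniqueness, with the member of the chain found for [m']. *)
Lemma minkowski_chain_cover (n m : nat) (alpha : nat -> R) (B : nat -> nat -> nat -> Z) :
  Q_lin_indep_with_1 n alpha -> minkowski_chain n alpha B -> (1 <= m)%nat ->
  exists k, is_A n alpha m (B k).
Proof.
  intros HQ (mk & _ & HA & Hnew).
  induction m as [m IH] using lt_wf_ind. intros Hm.
  destruct (classic (new_A n alpha m)) as [Hn|Hn].
  - apply Hnew in Hn. destruct Hn as [k ->]. exists k. apply HA.
  (* The negation of [new_A] hands over a matrix for [m] itself together with the earlier one. *)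
  - assert (He : exists W m' W', is_A n alpha m W /\ (1 <= m')%nat /\ (m' < m)%nat /\
      is_A n alpha m' W' /\ mx_eq (S n) W W').
    { apply NNPP; intro Hno. apply Hn. split; [exact Hm|].
      intros W HW m' W' H1 H2 H3 H4. apply Hno. exists W, m', W'. auto. }
    destruct He as (W & m' & W' & HW & H1 & H2 & HW' & Heq).
    destruct (IH m' H2 H1) as [k Hk]. exists k.
    pose proof (is_A_unique _ _ _ _ _ HQ HW' Hk) as Heq'.
    apply (is_A_mx_eq _ _ _ W); [|exact HW].
    intros i j Hi Hj. rewrite (Heq i j Hi Hj). apply Heq'; assumption.
Qed.

(** * Lower bound for the last minimum *)

Lemma last_minimum_lower (n m : nat) (alpha : nat -> R) (W : nat -> nat -> Z) :
  is_A n alpha m W ->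
  1 <= INR (S n * (2 * S n * m + 1) ^ n) * Rabs (xi n alpha (W n)).
Proof.
  intros HA. set (C := ((2 * S n * m + 1) ^ n)%nat).
  (* The matrix is transposed: the equations are the first [n] coordinates, the unknowns are the
     coefficients of the [S n] rows of [W]. *)
  destruct (siegel_kernel_vector n m (fun t j => W j t)) as (b & (j0 & Hj0 & Hb0) & HbC & Hker).
  { intros t j Ht Hj. destruct (HA j Hj) as (Hb & _). apply Hb. lia. }
  fold C in HbC.
  set (z := fun t => sumZ (fun j => W j t * b j)%Z (S n)).
  assert (Hxi : xi n alpha z = IZR (z n)).
  { unfold xi. rewrite sumR_zero; [ring|]. intros t Ht.
    unfold z. rewrite (Hker t Ht). ring. }
  assert (Hle : Rabs (xi n alpha z) <= INR (S n * C) * Rabs (xi n alpha (W n))).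
  { unfold z. rewrite xi_comb. eapply Rle_trans; [apply sumR_abs_le|].
    rewrite mult_INR, Rmult_assoc, <- sumR_const. apply sumR_le. intros j Hj.
    rewrite Rabs_mult. apply Rmult_le_compat; try apply Rabs_pos.
    - rewrite <- abs_IZR, INR_IZR_INZ. apply IZR_le, HbC.
    - apply (is_A_xi_le_last n m); [exact HA|lia]. }
  apply Rnot_lt_le; intro Hlt. apply Hb0.
  assert (Hzn : z n = 0%Z).
  { assert (Hz : Rabs (IZR (z n)) < 1) by (rewrite <- Hxi; lra).
    rewrite <- abs_IZR in Hz. apply lt_IZR in Hz. lia. }
  (* Now every coordinate of [z] is 0, so [b] is a relation among the rows of [W]. *)
  assert (Hc : (inject_Z (b j0) == 0)%Q).
  { apply (is_A_rows_indep _ _ _ _ HA (fun t => inject_Z (b t))); [|exact Hj0].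
    intros j Hj. apply Qeq0_of_Q2R. rewrite Q2R_sumQ.
    rewrite (sumR_ext _ (fun t => IZR (W t j * b t))).
    - rewrite <- IZR_sumZ. fold (z j).
      destruct (Nat.eq_dec j n) as [->|]; [rewrite Hzn; reflexivity|].
      unfold z. rewrite Hker by lia. reflexivity.
    - intros t _. rewrite Q2R_mult, !Q2R_inject_Z, mult_IZR. ring. }
  unfold Qeq in Hc; simpl in Hc. lia.
Qed.

(** * Distance to the nearest integer, and bad approximability in terms of [xi] *)

Lemma dist_Z_le (t : R) (k : Z) : dist_Z t <= Rabs (t + IZR k).
Proof.
  unfold dist_Z. destruct (archimed t) as [H1 H2].
  destruct (Z_le_gt_dec (- k) (up t - 1)) as [Hk|Hk].
  - apply IZR_le in Hk. rewrite opp_IZR in Hk.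
    eapply Rle_trans; [apply Rmin_l|]. eapply Rle_trans; [|apply Rle_abs]. lra.
  - assert (Hk' : (up t <= - k)%Z) by lia. apply IZR_le in Hk'. rewrite opp_IZR in Hk'.
    eapply Rle_trans; [apply Rmin_r|]. rewrite <- Rabs_Ropp.
    eapply Rle_trans; [|apply Rle_abs]. lra.
Qed.

(** The bound on [p] later keeps the integer vector with last entry [- p] inside the box. *)
Lemma dist_Z_attained (t : R) :
  exists p : Z, dist_Z t = Rabs (t - IZR p) /\ Rabs (IZR p) <= Rabs t + 1.
Proof.
  unfold dist_Z. destruct (archimed t) as [H1 H2].
  unfold Rmin. destruct Rle_dec as [Hle|Hle].
  - exists (up t - 1)%Z. rewrite minus_IZR. split; unfold Rabs; repeat destruct Rcase_abs; lra.
  - exists (up t). split; unfold Rabs; repeat destruct Rcase_abs; lra.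
Qed.

(** The last entry of [z] is one of the integers competing in [dist_Z]. The constant is capped at 1
    to cover, later, vectors whose only nonzero entry is the last. *)
Lemma badly_approximable_xi (n : nat) (alpha : nat -> R) :
  badly_approximable n alpha ->
  exists c, 0 < c <= 1 /\ forall z : nat -> Z, (exists i, (i < n)%nat /\ z i <> 0%Z) ->
    c / IZR (supnormZ z n) ^ n <= Rabs (xi n alpha z).
Proof.
  intros (c & Hc & H). exists (Rmin c 1).
  split; [split; [apply Rmin_pos; lra|apply Rmin_r]|].
  intros z Hz. specialize (H z Hz).
  pose proof (dist_Z_le (L_form n alpha z) (z n)) as Hd.
  change (L_form n alpha z + IZR (z n)) with (xi n alpha z) in Hd.
  destruct Hz as (i & Hi & Hzi).
  pose proof (IZR_le _ _ (supnormZ_ge_1 z n i Hi Hzi)) as HS.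
  assert (Rmin c 1 / IZR (supnormZ z n) ^ n <= c / IZR (supnormZ z n) ^ n); [|lra].
  apply Rmult_le_compat_r; [|apply Rmin_l].
  apply Rlt_le, Rinv_0_lt_compat, pow_lt. lra.
Qed.

(** * Dirichlet's argument inside a hyperplane *)

Definition nat_floor (r : R) : nat := Z.to_nat (Int_part r).

Lemma nat_floor_spec (r : R) :
  0 <= r -> INR (nat_floor r) <= r < INR (nat_floor r) + 1.
Proof.
  intros Hr. destruct (base_Int_part r) as [H1 H2].
  assert (H3 : (-1 < Int_part r)%Z) by (apply lt_IZR; lra).
  unfold nat_floor. rewrite INR_IZR_INZ, Z2Nat.id by lia. lra.
Qed.

Lemma nat_floor_lt (r : R) (d : nat) : 0 <= r < INR d -> (nat_floor r < d)%nat.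
Proof. intros Hr. apply INR_lt. pose proof (nat_floor_spec r). lra. Qed.

Lemma argmax_abs (e : nat -> R) (n : nat) :
  exists i, (i <= n)%nat /\ forall j, (j <= n)%nat -> Rabs (e j) <= Rabs (e i).
Proof.
  induction n as [|n (i & Hi & H)].
  - exists 0%nat. split; [lia|]. intros j Hj. replace j with 0%nat by lia. lra.
  - destruct (Rle_dec (Rabs (e i)) (Rabs (e (S n)))) as [Hle|Hle].
    + exists (S n). split; [lia|]. intros j Hj.
      destruct (Nat.eq_dec j (S n)) as [->|]; [lra|]. specialize (H j ltac:(lia)). lra.
    + exists i. split; [lia|]. intros j Hj.
      destruct (Nat.eq_dec j (S n)) as [->|]; [lra|]. apply H. lia.
Qed.

(** Solve the equation for [t i]: since [e i] is the largest coefficient, each of the other terms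
    contributes at most [eps] after division by it. *)
Lemma hyperplane_coord_bound (k i : nat) (e t : nat -> R) (eps : R) :
  (i < k)%nat -> e i <> 0 -> 0 <= eps ->
  (forall j, (j < k)%nat -> Rabs (e j) <= Rabs (e i)) ->
  (forall j, (j < k)%nat -> j <> i -> Rabs (t j) <= eps) ->
  sumR (fun j => e j * t j) k = 0 ->
  forall j, (j < k)%nat -> Rabs (t j) <= INR k * eps.
Proof.
  intros Hi He Heps Hmax Ht H0 j Hj.
  assert (Hk : 1 <= INR k) by (apply (le_INR 1); lia).
  destruct (Nat.eq_dec j i) as [->|Hne].
  2:{ specialize (Ht j Hj Hne). nra. }
  rewrite (sumR_single _ i) in H0 by exact Hi.
  set (r := sumR _ k) in H0.
  assert (Hr : Rabs r <= Rabs (e i) * (INR k * eps)).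
  { eapply Rle_trans; [apply sumR_abs_le|].
    replace (Rabs (e i) * (INR k * eps)) with (INR k * (Rabs (e i) * eps)) by ring.
    rewrite <- sumR_const. apply sumR_le. intros s Hs.
    destruct (Nat.eqb_spec s i).
    - rewrite Rabs_R0. apply Rmult_le_pos; [apply Rabs_pos|exact Heps].
    - rewrite Rabs_mult. apply Rmult_le_compat; try apply Rabs_pos; auto. }
  apply Rmult_le_reg_l with (Rabs (e i)); [apply Rabs_pos_lt, He|].
  rewrite <- Rabs_mult. replace (e i * t i) with (- r) by lra.
  rewrite Rabs_Ropp. exact Hr.
Qed.

(* The largest coefficient [e i] (after rescaling) singles out the coordinate
   that the hyperplane controls by the others, so the pigeonhole may ignore it:
   there are only [D ^ n * N] boxes instead of [D ^ S n * N]. *)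
Lemma dirichlet_in_hyperplane (n X D N : nat) (alpha e : nat -> R) :
  (1 <= X)%nat -> (1 <= D)%nat -> (1 <= N)%nat -> (D ^ n * N < X ^ n)%nat ->
  (exists j, (j <= n)%nat /\ e j <> 0) ->
  exists z : nat -> Z,
    (exists i, (i < n)%nat /\ z i <> 0%Z) /\
    (forall j, (j < n)%nat -> Rabs (IZR (z j)) <= INR X - 1) /\
    Rabs (xi n alpha z) < / INR N /\
    (sumR (fun j => e j * IZR (z j)) n + e n * xi n alpha z = 0 ->
      (forall j, (j < n)%nat -> Rabs (IZR (z j)) <= INR (S n) * INR X / INR D) /\
      Rabs (xi n alpha z) <= INR (S n) / (INR N * INR D)).
Proof.
  intros HX HD HN Hlt (j0 & Hj0 & Hej0).
  assert (RX : 1 <= INR X) by (apply (le_INR 1); exact HX).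
  assert (RD : 1 <= INR D) by (apply (le_INR 1); exact HD).
  assert (RN : 1 <= INR N) by (apply (le_INR 1); exact HN).
  (* In the scaled coordinates [z j / X] for [j < n] and [N * xi z], the equation of the hyperplane
     has the coefficients [e']. *)
  set (e' := fun j => if Nat.ltb j n then e j * INR X else e j / INR N).
  destruct (argmax_abs e' n) as (i & Hi & Hmax).
  assert (Hei : e' i <> 0).
  { intros H0. specialize (Hmax j0 Hj0). rewrite H0, Rabs_R0 in Hmax.
    assert (Hpos : 0 < Rabs (e' j0)); [|lra].
    apply Rabs_pos_lt. unfold e'. destruct (Nat.ltb j0 n).
    - apply Rmult_integral_contrapositive. split; [exact Hej0|lra].
    - apply Rmult_integral_contrapositive. split; [exact Hej0|].
      apply Rinv_neq_0_compat. lra. }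
  set (L := fun x : nat -> nat => sumR (fun j => INR (x j) * alpha j) n).
  set (h := fun x => INR N * frac_part (L x)).
  assert (Hh : forall x, 0 <= h x < INR N).
  { intros x. unfold h. destruct (base_fp (L x)). nra. }
  (* Scaled coordinates in [0, 1). The one of index [n] is the position of [h x] within its unit
     interval, whose number [nat_floor (h x)] is the value of [G] in the pigeonhole. *)
  set (u := fun (x : nat -> nat) j =>
    if Nat.ltb j n then INR (x j) / INR X else h x - INR (nat_floor (h x))).
  assert (Hu : forall x j, (forall i, (x i < X)%nat) -> 0 <= u x j < 1).
  { intros x j Hx. unfold u. destruct (Nat.ltb j n).
    - pose proof (lt_INR _ _ (Hx j)) as H1. pose proof (pos_INR (x j)).
      split.
      + apply Rmult_le_pos; [lra|]. apply Rlt_le, Rinv_0_lt_compat. lra.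
      + apply Rmult_lt_reg_r with (INR X); [lra|].
        unfold Rdiv. rewrite Rmult_assoc, Rinv_l by lra. lra.
    - pose proof (nat_floor_spec (h x)). specialize (Hh x). lra. }
  (* Enumerates the [n] indices up to [n] other than [i]. *)
  set (skip := fun j => if Nat.ltb j i then j else S j).
  destruct (pigeonhole_box X n D n N (fun x j => nat_floor (INR D * u x (skip j)))
    (fun x => nat_floor (h x))) as (x & y & Hx & Hy & (i0 & Hi0 & Hne) & HF & HG).
  - exact HX.
  - intros x Hx. split.
    + intros j _. apply nat_floor_lt. specialize (Hu x (skip j) Hx). nra.
    + apply nat_floor_lt, Hh.
  - exact Hlt.
  (* The last entry is chosen so that [xi z] is the difference of the fractional parts of [L x] and
     [L y]. *)
  - set (z := fun j => if Nat.ltb j n then (Z.of_nat (x j) - Z.of_nat (y j))%Z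
                       else (Int_part (L y) - Int_part (L x))%Z).
    assert (Hzj : forall j, (j < n)%nat -> IZR (z j) = INR (x j) - INR (y j)).
    { intros j Hj. unfold z. rewrite (proj2 (Nat.ltb_lt j n) Hj).
      rewrite minus_IZR, <- !INR_IZR_INZ. reflexivity. }
    assert (Hxi : INR N * xi n alpha z = h x - h y).
    { unfold h, frac_part.
      assert (Hx0 : xi n alpha z =
        L x - IZR (Int_part (L x)) - (L y - IZR (Int_part (L y)))); [|rewrite Hx0; ring].
      unfold xi. unfold z at 2. rewrite Nat.ltb_irrefl, minus_IZR.
      rewrite (sumR_ext _ (fun j => INR (x j) * alpha j + (-1) * (INR (y j) * alpha j)))
        by (intros j Hj; rewrite (Hzj j Hj); ring).
      rewrite sumR_plus, sumR_scal. unfold L. ring. }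
    set (t := fun j => u x j - u y j).
    assert (Htj : forall j, (j < n)%nat -> IZR (z j) = INR X * t j).
    { intros j Hj. rewrite (Hzj j Hj). unfold t, u.
      rewrite (proj2 (Nat.ltb_lt j n) Hj). field. lra. }
    assert (Htn : INR N * xi n alpha z = t n).
    { rewrite Hxi. unfold t, u. rewrite Nat.ltb_irrefl, HG. ring. }
    assert (Habs : Rabs (t n) < 1).
    { pose proof (Hu x n Hx). pose proof (Hu y n Hy). unfold t.
      apply Rabs_def1; lra. }
    rewrite <- Htn, Rabs_mult, (Rabs_pos_eq (INR N)) in Habs by lra.
    exists z. split; [|split; [|split]].
    + exists i0. split; [exact Hi0|]. unfold z.
      rewrite (proj2 (Nat.ltb_lt i0 n) Hi0). lia.
    + intros j Hj. rewrite (Hzj j Hj).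
      pose proof (pos_INR (x j)). pose proof (pos_INR (y j)).
      pose proof (le_INR _ _ (Hx j)) as H1. pose proof (le_INR _ _ (Hy j)) as H2.
      rewrite S_INR in H1, H2. apply Rabs_le. lra.
    + apply Rmult_lt_reg_l with (INR N); [lra|]. rewrite Rinv_r by lra. exact Habs.
    + intros Hplane.
      assert (Hbound : forall j, (j < S n)%nat -> Rabs (t j) <= INR (S n) * / INR D).
      { apply (hyperplane_coord_bound (S n) i e').
        - lia.
        - exact Hei.
        - apply Rlt_le, Rinv_0_lt_compat. lra.
        - intros j Hj. apply Hmax. lia.
        (* For every coordinate except [i], the collision puts [u x] and [u y] into the same
           interval of length [/ D]. *)
        - intros j Hj Hji.
          assert (Hs : exists j', (j' < n)%nat /\ skip j' = j).
          { destruct (lt_dec j i) as [Hl|Hl].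
            - exists j. split; [lia|]. unfold skip.
              rewrite (proj2 (Nat.ltb_lt j i) Hl). reflexivity.
            - exists (j - 1)%nat. split; [lia|]. unfold skip.
              rewrite (proj2 (Nat.ltb_ge (j - 1) i)) by lia. lia. }
          destruct Hs as (j' & Hj' & Hs). specialize (HF j' Hj'). simpl in HF.
          rewrite Hs in HF.
          pose proof (Hu x j Hx). pose proof (Hu y j Hy).
          pose proof (nat_floor_spec (INR D * u x j) ltac:(nra)) as F1.
          pose proof (nat_floor_spec (INR D * u y j) ltac:(nra)) as F2.
          rewrite HF in F1.
          apply Rmult_le_reg_l with (INR D); [lra|]. rewrite Rinv_r by lra.
          rewrite <- (Rabs_pos_eq (INR D)) at 1 by lra. rewrite <- Rabs_mult.
          unfold t. apply Rabs_le. lra.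
        - simpl. rewrite <- Hplane. f_equal.
          + apply sumR_ext. intros j Hj. rewrite (Htj j Hj). unfold e'.
            rewrite (proj2 (Nat.ltb_lt j n) Hj). ring.
          + unfold e'. rewrite Nat.ltb_irrefl, <- Htn. field. lra. }
      split.
      * intros j Hj. rewrite (Htj j Hj), Rabs_mult, (Rabs_pos_eq (INR X)) by lra.
        specialize (Hbound j ltac:(lia)).
        replace (INR (S n) * INR X / INR D) with (INR X * (INR (S n) * / INR D))
          by (field; lra).
        apply Rmult_le_compat_l; [lra|exact Hbound].
      * specialize (Hbound n ltac:(lia)).
        rewrite <- Htn, Rabs_mult, (Rabs_pos_eq (INR N)) in Hbound by lra.
        apply Rmult_le_reg_l with (INR N); [lra|].
        replace (INR N * (INR (S n) / (INR N * INR D))) with (INR (S n) * / INR D)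
          by (field; lra).
        exact Hbound.
Qed.

(** * The two extreme minima of a badly approximable form *)

(** If the conclusion fails, the Dirichlet vector [z] lies in the box and has [xi] below the last
    minimum, so it lies in the hyperplane of the first [n] rows. There it is smaller by a factor of
    order [D], both in norm and in [xi], which contradicts bad approximability for large [D]. *)
Lemma last_minimum_upper (n m X D N A : nat) (alpha : nat -> R) (c : R)
    (W : nat -> nat -> Z) :
  is_A n alpha m W -> 0 < c ->
  (forall z : nat -> Z, (exists i, (i < n)%nat /\ z i <> 0%Z) ->
    c / IZR (supnormZ z n) ^ n <= Rabs (xi n alpha z)) ->
  sumR (fun j => Rabs (alpha j)) n + 1 <= INR A ->
  (1 <= X)%nat -> (1 <= D)%nat -> (1 <= N)%nat -> (A * X <= m)%nat ->
  (D ^ n * N < X ^ n <= 2 * (D ^ n * N))%nat ->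
  2 * INR (S n) ^ S n < c * INR D ->
  Rabs (xi n alpha (W n)) < / INR N.
Proof.
  intros HA Hc Hba HAl HX HD HN Hm [Hlt Hle] HcD.
  apply Rnot_le_lt; intro Hlarge.
  destruct (siegel_kernel_vector n m W) as (b & (j0 & Hj0 & Hb0) & _ & Hker).
  { intros t j Ht Hj. destruct (HA t ltac:(lia)) as (Hb & _). apply Hb, Hj. }
  (* The equation with normal [b], rewritten by eliminating the last entry of [z] in favour of
     [xi z]. *)
  set (e := fun j => if Nat.ltb j n then IZR (b j) - IZR (b n) * alpha j else IZR (b n)).
  assert (He : exists j, (j <= n)%nat /\ e j <> 0).
  { destruct (Z.eq_dec (b n) 0) as [Hbn|Hbn].
    - exists j0. split; [lia|]. unfold e. rewrite Hbn.
      assert (j0 <> n) by congruence.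
      rewrite (proj2 (Nat.ltb_lt j0 n)) by lia.
      rewrite Rmult_0_l, Rminus_0_r. apply not_0_IZR, Hb0.
    - exists n. split; [lia|]. unfold e. rewrite Nat.ltb_irrefl.
      apply not_0_IZR, Hbn. }
  destruct (dirichlet_in_hyperplane n X D N alpha e HX HD HN Hlt He)
    as (z & Hznz & HzX & Hzxi & Hplane).
  assert (RX : 1 <= INR X) by (apply (le_INR 1); exact HX).
  assert (RD : 1 <= INR D) by (apply (le_INR 1); exact HD).
  assert (RN : 1 <= INR N) by (apply (le_INR 1); exact HN).
  assert (Hsum : 0 <= sumR (fun j => Rabs (alpha j)) n)
    by (apply sumR_nonneg; intros; apply Rabs_pos).
  assert (Rm : INR A * INR X <= INR m) by (rewrite <- mult_INR; apply le_INR, Hm).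
  (* The last entry is [xi z] minus a sum bounded through [X - 1] and the absolute values of
     [alpha]; the factor [A] leaves room for it. *)
  assert (Hbound : bounded_by (S n) (Z.of_nat m) z).
  { intros j Hj. apply le_IZR. rewrite abs_IZR, <- INR_IZR_INZ.
    destruct (Nat.eq_dec j n) as [->|Hne].
    - replace (IZR (z n)) with
        (xi n alpha z + - sumR (fun j => IZR (z j) * alpha j) n) by (unfold xi; ring).
      eapply Rle_trans; [apply Rabs_triang|]. rewrite Rabs_Ropp.
      assert (H1 : Rabs (sumR (fun j => IZR (z j) * alpha j) n) <=
                   (INR X - 1) * sumR (fun j => Rabs (alpha j)) n).
      { eapply Rle_trans; [apply sumR_abs_le|]. rewrite <- sumR_scal.
        apply sumR_le. intros i Hi. rewrite Rabs_mult.
        apply Rmult_le_compat_r; [apply Rabs_pos|]. apply HzX, Hi. }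
      assert (H2 : / INR N <= 1) by (rewrite <- Rinv_1; apply Rinv_le_contravar; lra).
      nra.
    - specialize (HzX j ltac:(lia)). nra. }
  assert (Hbz : sumZ (fun j => z j * b j)%Z (S n) = 0%Z).
  { destruct (Z.eq_dec (sumZ (fun j => z j * b j)%Z (S n)) 0) as [H0|H0]; [exact H0|].
    exfalso. destruct (HA n ltac:(lia)) as (_ & _ & _ & Hmin).
    specialize (Hmin z Hbound). apply (Rlt_irrefl (/ INR N)).
    apply Rle_lt_trans with (2 := Hzxi). eapply Rle_trans; [exact Hlarge|].
    apply Hmin. apply (indep_of_prev_functional _ _ _ b); [|exact Hker|exact H0].
    apply rows_indep_pred, (is_A_rows_indep _ _ _ _ HA). }
  destruct Hplane as [Hzsmall Hxismall].
  { apply IZR_eq in Hbz. rewrite IZR_sumZ in Hbz. rewrite <- Hbz.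
    unfold e, xi. rewrite Nat.ltb_irrefl. simpl.
    rewrite (sumR_ext _ (fun j => IZR (z j * b j) + - IZR (b n) * (IZR (z j) * alpha j))).
    - rewrite sumR_plus, sumR_scal, mult_IZR. ring.
    - intros j Hj. rewrite (proj2 (Nat.ltb_lt j n) Hj), mult_IZR. ring. }
  specialize (Hba z Hznz). destruct Hznz as (i & Hi & Hzi).
  pose proof (IZR_le _ _ (supnormZ_ge_1 z n i Hi Hzi)) as HS1.
  set (s := IZR (supnormZ z n)) in *.
  assert (Rn : 1 <= INR (S n)) by (apply (le_INR 1); lia).
  assert (Hs : s <= INR (S n) * INR X / INR D).
  { apply supnormZ_leR; [|exact Hzsmall].
    apply Rmult_le_pos; [nra|]. apply Rlt_le, Rinv_0_lt_compat. lra. }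
  assert (Hsn : 0 < s ^ n) by (apply pow_lt; lra).
  assert (Hsp : s ^ n <= (INR (S n) * INR X / INR D) ^ n) by (apply pow_incr; lra).
  assert (HDn : 0 < INR D ^ n) by (apply pow_lt; lra).
  assert (Hpow : (INR (S n) * INR X / INR D) ^ n * INR D ^ n = INR (S n) ^ n * INR X ^ n).
  { rewrite <- !Rpow_mult_distr. f_equal. field. lra. }
  assert (HXn : INR X ^ n <= 2 * (INR D ^ n * INR N)).
  { apply le_INR in Hle. rewrite !mult_INR, !pow_INR in Hle. simpl INR in Hle. lra. }
  assert (H1 : c <= INR (S n) / (INR N * INR D) * s ^ n).
  { apply Rmult_le_reg_r with (/ s ^ n); [apply Rinv_0_lt_compat, Hsn|].
    rewrite Rmult_assoc, Rinv_r, Rmult_1_r by lra.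
    apply Rle_trans with (1 := Hba). exact Hxismall. }
  assert (H2 : c * (INR N * INR D) <= INR (S n) * s ^ n).
  { replace (INR (S n) * s ^ n) with
      (INR (S n) / (INR N * INR D) * s ^ n * (INR N * INR D)) by (field; lra).
    apply Rmult_le_compat_r; [nra|exact H1]. }
  assert (H3 : c * (INR N * INR D) * INR D ^ n <= INR (S n) * (INR (S n) ^ n * INR X ^ n)).
  { rewrite <- Hpow, <- (Rmult_assoc (INR (S n))).
    apply Rmult_le_compat_r; [lra|]. eapply Rle_trans; [exact H2|].
    apply Rmult_le_compat_l; lra. }
  assert (HP : 0 < INR (S n) ^ S n) by (apply pow_lt; lra).
  (* Inserting the norm bound and [X ^ n <= 2 * D ^ n * N] leaves [c * D <= 2 * S n ^ S n], against
     the choice of [D]. *)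
  assert (H4 : c * INR D * (INR N * INR D ^ n) <= 2 * INR (S n) ^ S n * (INR N * INR D ^ n)).
  { replace (c * INR D * (INR N * INR D ^ n)) with (c * (INR N * INR D) * INR D ^ n) by ring.
    eapply Rle_trans; [exact H3|].
    replace (INR (S n) * (INR (S n) ^ n * INR X ^ n)) with (INR (S n) ^ S n * INR X ^ n)
      by (rewrite <- tech_pow_Rmult; ring).
    replace (2 * INR (S n) ^ S n * (INR N * INR D ^ n)) with
      (INR (S n) ^ S n * (2 * (INR D ^ n * INR N))) by ring.
    apply Rmult_le_compat_l; lra. }
  apply Rmult_le_reg_r in H4; [lra|]. nra.
Qed.

(** If the first [n] entries of the first row vanish, [xi] equals its last entry, a positive
    integer, and [c <= 1] suffices. Otherwise the norm is at most [m]. *)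
Lemma first_minimum_lower (n m : nat) (alpha : nat -> R) (c : R) (W : nat -> nat -> Z) :
  is_A n alpha m W -> 0 < c <= 1 -> (1 <= m)%nat ->
  (forall z : nat -> Z, (exists i, (i < n)%nat /\ z i <> 0%Z) ->
    c / IZR (supnormZ z n) ^ n <= Rabs (xi n alpha z)) ->
  c / INR m ^ n <= Rabs (xi n alpha (W 0%nat)).
Proof.
  intros HA Hc Hm Hba. destruct (HA 0%nat ltac:(lia)) as (Hb & _ & (j & Hj & _ & Hjp) & _).
  assert (Rm : 1 <= INR m) by (apply (le_INR 1); exact Hm).
  destruct (classic (exists i, (i < n)%nat /\ W 0%nat i <> 0%Z)) as [Hz|Hz].
  - eapply Rle_trans; [|apply Hba, Hz]. destruct Hz as (i & Hi & Hzi).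
    pose proof (IZR_le _ _ (supnormZ_ge_1 _ n i Hi Hzi)) as HS1.
    apply Rmult_le_compat_l; [lra|]. apply Rinv_le_contravar; [apply pow_lt; lra|].
    apply pow_incr. split; [lra|]. apply supnormZ_leR; [lra|].
    intros s Hs. rewrite <- abs_IZR, INR_IZR_INZ. apply IZR_le, Hb. lia.
  - assert (Hz' : forall i, (i < n)%nat -> W 0%nat i = 0%Z).
    { intros i Hi. apply NNPP; intro. apply Hz. exists i. auto. }
    assert (j = n) as ->.
    { destruct (Nat.eq_dec j n); [assumption|]. rewrite Hz' in Hjp; lia. }
    unfold xi. rewrite sumR_zero by (intros i Hi; rewrite Hz' by exact Hi; ring).
    rewrite Rplus_0_l.
    assert (H1 : 1 <= IZR (W 0%nat n)) by (apply IZR_le; lia).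
    rewrite Rabs_pos_eq by lra.
    pose proof (pow_R1_Rle (INR m) n Rm) as H2.
    apply Rmult_le_reg_r with (INR m ^ n); [lra|].
    unfold Rdiv. rewrite Rmult_assoc, Rinv_l by lra. nra.
Qed.

(** * The ratio of the extreme minima and the equivalence *)

Lemma beta_xi (n : nat) (alpha : nat -> R) (M : nat -> nat -> Z) (i : nat) :
  beta n alpha M i = xi n alpha (M i).
Proof.
  unfold beta, xi. simpl. unfold ext_alpha at 2. rewrite Nat.ltb_irrefl, Rmult_1_r.
  f_equal. apply sumR_ext. intros j Hj. unfold ext_alpha.
  rewrite (proj2 (Nat.ltb_lt j n) Hj). reflexivity.
Qed.

Lemma alpha_k1_ge (n m : nat) (alpha : nat -> R) (W : nat -> nat -> Z) (delta : R) :
  is_A n alpha m W ->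
  (Rabs (alpha_k1 n alpha W) >= delta <->
   delta * Rabs (xi n alpha (W n)) <= Rabs (xi n alpha (W 0%nat))).
Proof.
  intros HA. unfold alpha_k1. rewrite !beta_xi.
  (* The lower bound for the last minimum also shows that the denominator is nonzero. *)
  assert (Hpos : 0 < Rabs (xi n alpha (W n))).
  { pose proof (last_minimum_lower _ _ _ _ HA) as H.
    destruct (Rabs_pos (xi n alpha (W n))) as [Hp|Hp]; [exact Hp|].
    rewrite <- Hp, Rmult_0_r in H. lra. }
  assert (Hne : xi n alpha (W n) <> 0) by (intros H; rewrite H, Rabs_R0 in Hpos; lra).
  assert (Heq : Rabs (xi n alpha (W 0%nat)) =
    Rabs (xi n alpha (W 0%nat) / xi n alpha (W n)) * Rabs (xi n alpha (W n))).
  { rewrite <- Rabs_mult. f_equal. field. exact Hne. }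
  rewrite Heq. split; intros H.
  - apply Rmult_le_compat_r; lra.
  - apply Rmult_le_reg_r in H; lra.
Qed.

Lemma nat_above (r : R) : exists k : nat, (1 <= k)%nat /\ r <= INR k.
Proof.
  destruct (INR_unbounded r) as [k Hk]. exists (S k). split; [lia|].
  rewrite S_INR. lra.
Qed.

Lemma badly_approximable_ratio (n : nat) (alpha : nat -> R) :
  (1 <= n)%nat -> badly_approximable n alpha ->
  exists delta, 0 < delta /\ forall m W, (1 <= m)%nat -> is_A n alpha m W ->
    delta * Rabs (xi n alpha (W n)) <= Rabs (xi n alpha (W 0%nat)).
Proof.
  intros Hn Hba. destruct (badly_approximable_xi n alpha Hba) as (c & Hc & Hxi).
  destruct (nat_above (sumR (fun j => Rabs (alpha j)) n + 1)) as (A & HA1 & HA).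
  destruct (nat_above (2 * INR (S n) ^ S n / c + 1)) as (D & HD1 & HD).
  assert (HcD : 2 * INR (S n) ^ S n < c * INR D).
  { replace (2 * INR (S n) ^ S n) with (c * (2 * INR (S n) ^ S n / c)) by (field; lra).
    apply Rmult_lt_compat_l; lra. }
  (* From [m >= T] on, [X = m / A] exceeds [D] and [last_minimum_upper] applies. Below [T] the
     trivial bound for [xi] on the box is enough, and [d1] is the constant for that range. *)
  set (T := (A * (D + 1))%nat).
  assert (HT1 : (1 <= T)%nat) by (unfold T; nia).
  assert (RT : 1 <= INR T) by (apply (le_INR 1); exact HT1).
  assert (RA : 1 <= INR A) by (apply (le_INR 1); exact HA1).
  assert (RD : 1 <= INR D) by (apply (le_INR 1); exact HD1).
  pose proof (pow_R1_Rle (INR T) n RT) as HTn.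
  pose proof (pow_R1_Rle (2 * INR A) n ltac:(lra)) as HAn.
  pose proof (pow_R1_Rle (INR D) n RD) as HDn.
  set (d1 := c / (INR T ^ n * (INR T * INR A))).
  set (d2 := c / (2 * (2 * INR A) ^ n * INR D ^ n)).
  assert (Hd1 : 0 < d1) by (apply Rdiv_lt_0_compat; [lra|]; apply Rmult_lt_0_compat; nra).
  assert (Hd2 : 0 < d2).
  { apply Rdiv_lt_0_compat; [lra|]. apply Rmult_lt_0_compat; lra. }
  exists (Rmin d1 d2). split; [apply Rmin_pos; assumption|].
  intros m W Hm HW.
  pose proof (first_minimum_lower n m alpha c W HW Hc Hm Hxi) as Hlow.
  assert (Rm : 1 <= INR m) by (apply (le_INR 1); exact Hm).
  pose proof (pow_R1_Rle (INR m) n Rm) as Hmn.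
  pose proof (Rabs_pos (xi n alpha (W n))) as Hpos.
  eapply Rle_trans; [|exact Hlow].
  destruct (le_lt_dec T m) as [HTm|HTm].
  - apply Rle_trans with (d2 * Rabs (xi n alpha (W n)));
      [apply Rmult_le_compat_r; [exact Hpos|apply Rmin_r]|].
    set (X := (m / A)%nat).
    assert (HX1 : (A * X <= m)%nat) by (apply Nat.Div0.mul_div_le).
    assert (HX2 : (m < A * S X)%nat) by (apply Nat.mul_succ_div_gt; lia).
    assert (HXD : (D < X)%nat) by (unfold T in HTm; nia).
    (* Here [1 <= n] enters; the strict inequality makes [N] positive. *)
    assert (HDX : (D ^ n < X ^ n)%nat) by (apply Nat.pow_lt_mono_l; lia).
    assert (HDnz : (D ^ n <> 0)%nat) by (apply Nat.pow_nonzero; lia).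
    (* The largest [N] with [D ^ n * N < X ^ n]; subtracting 1 keeps the inequality strict. As
       [N >= 1], maximality gives [X ^ n <= 2 * (D ^ n * N)]. *)
    set (N := ((X ^ n - 1) / D ^ n)%nat).
    assert (HN1 : (D ^ n * N <= X ^ n - 1)%nat) by (apply Nat.Div0.mul_div_le).
    assert (HN2 : (X ^ n - 1 < D ^ n * S N)%nat) by (apply Nat.mul_succ_div_gt; exact HDnz).
    assert (HN : (1 <= N)%nat) by nia.
    pose proof (last_minimum_upper n m X D N A alpha c W HW ltac:(lra) Hxi HA
      ltac:(lia) HD1 HN HX1 ltac:(nia) HcD) as Hup.
    assert (RN : 1 <= INR N) by (apply (le_INR 1); exact HN).
    assert (HXn : INR X ^ n <= 2 * (INR D ^ n * INR N)).
    { rewrite <- !pow_INR, <- mult_INR. change 2 with (INR 2). rewrite <- mult_INR.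
      apply le_INR. nia. }
    (* From [m < A * S X <= 2 * A * X]. With [HXn] this bounds [m ^ n] by a constant times [N], and
       [d2] is [c] divided by that constant. *)
    assert (HmX : INR m ^ n <= (2 * INR A) ^ n * INR X ^ n).
    { rewrite <- Rpow_mult_distr. apply pow_incr. split; [lra|].
      change 2 with (INR 2). rewrite <- !mult_INR. apply le_INR. nia. }
    apply Rle_trans with (d2 * / INR N); [apply Rmult_le_compat_l; lra|].
    replace (d2 * / INR N) with (c * / (2 * (2 * INR A) ^ n * INR D ^ n * INR N)).
    2:{ unfold d2. field. repeat split; try lra; apply pow_nonzero; lra. }
    apply Rmult_le_compat_l; [lra|]. apply Rinv_le_contravar; [lra|].
    eapply Rle_trans; [exact HmX|].
    replace (2 * (2 * INR A) ^ n * INR D ^ n * INR N) with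
      ((2 * INR A) ^ n * (2 * (INR D ^ n * INR N))) by ring.
    apply Rmult_le_compat_l; lra.
  - apply Rle_trans with (d1 * Rabs (xi n alpha (W n)));
      [apply Rmult_le_compat_r; [exact Hpos|apply Rmin_l]|].
    assert (RmT : INR m <= INR T) by (apply le_INR; lia).
    assert (Hup : Rabs (xi n alpha (W n)) <= INR T * INR A).
    { eapply Rle_trans; [apply (xi_abs_le n alpha (W n) (INR T))|].
      - destruct (HW n ltac:(lia)) as (Hb & _). intros j Hj.
        eapply Rle_trans; [|exact RmT]. rewrite <- abs_IZR, INR_IZR_INZ.
        apply IZR_le, Hb, Hj.
      - apply Rmult_le_compat_l; lra. }
    apply Rle_trans with (d1 * (INR T * INR A)); [apply Rmult_le_compat_l; lra|].
    replace (d1 * (INR T * INR A)) with (c * / INR T ^ n) by (unfold d1; field; lra).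
    apply Rmult_le_compat_l; [lra|]. apply Rinv_le_contravar; [lra|].
    apply pow_incr. lra.
Qed.

(** For [q] of norm [s] with nearest integer [p], the vector [z] formed by [q] and [- p] lies in the
    box of size [A * s]. So [xi z] is at least the first minimum there, which the ratio ties to the
    last one, of order at least [s ^ (- n)]. *)
Lemma ratio_badly_approximable (n : nat) (alpha : nat -> R) (delta : R) :
  0 < delta ->
  (forall m, (1 <= m)%nat -> exists W, is_A n alpha m W /\
    delta * Rabs (xi n alpha (W n)) <= Rabs (xi n alpha (W 0%nat))) ->
  badly_approximable n alpha.
Proof.
  intros Hd HW.
  destruct (nat_above (sumR (fun j => Rabs (alpha j)) n + 1)) as (A & HA1 & HA).
  assert (Hsum : 0 <= sumR (fun j => Rabs (alpha j)) n)
    by (apply sumR_nonneg; intros; apply Rabs_pos).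
  (* Comes from [last_minimum_lower] at [m = A * s], where
     [2 * S n * (A * s) + 1 <= 3 * S n * A * s]. *)
  set (K := INR (S n * (3 * S n * A) ^ n)).
  assert (HK : 0 < K).
  { apply (lt_INR 0). apply Nat.mul_pos_pos; [lia|].
    apply Nat.neq_0_lt_0, Nat.pow_nonzero. nia. }
  exists (delta / K). split; [apply Rdiv_lt_0_compat; assumption|].
  intros q (i & Hi & Hqi).
  destruct (dist_Z_attained (L_form n alpha q)) as (p & -> & Hp).
  pose proof (supnormZ_ge_1 q n i Hi Hqi) as HS.
  set (s := Z.to_nat (supnormZ q n)).
  assert (Hs : supnormZ q n = Z.of_nat s) by (unfold s; lia).
  rewrite Hs, <- INR_IZR_INZ.
  assert (Hs1 : (1 <= s)%nat) by lia.
  assert (Rs : 1 <= INR s) by (apply (le_INR 1); exact Hs1).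
  set (z := fun j => if Nat.ltb j n then q j else (- p)%Z).
  assert (Hxi : xi n alpha z = L_form n alpha q - IZR p).
  { unfold xi, L_form, z at 2. rewrite Nat.ltb_irrefl, opp_IZR.
    unfold Rminus. f_equal. apply sumR_ext. intros j Hj. unfold z.
    rewrite (proj2 (Nat.ltb_lt j n) Hj). reflexivity. }
  rewrite <- Hxi.
  destruct (HW (A * s)%nat ltac:(nia)) as (W & HWA & Hratio).
  assert (Hmin : Rabs (xi n alpha (W 0%nat)) <= Rabs (xi n alpha z)).
  { destruct (HWA 0%nat ltac:(lia)) as (_ & _ & _ & Hmin). apply Hmin.
    - intros j Hj. unfold z. destruct (Nat.ltb_spec j n) as [Hjn|Hjn].
      + pose proof (supnormZ_ge q n j Hjn). nia.
      + apply le_IZR. rewrite Z.abs_opp, abs_IZR, <- INR_IZR_INZ, mult_INR.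
        assert (HL : Rabs (L_form n alpha q) <= INR s * sumR (fun j => Rabs (alpha j)) n).
        { unfold L_form. eapply Rle_trans; [apply sumR_abs_le|]. rewrite <- sumR_scal.
          apply sumR_le. intros k Hk. rewrite Rabs_mult.
          apply Rmult_le_compat_r; [apply Rabs_pos|].
          rewrite <- abs_IZR, INR_IZR_INZ, <- Hs. apply IZR_le, supnormZ_ge, Hk. }
        nra.
    - apply (indep_of_prev_0 _ i); [lia|]. unfold z.
      rewrite (proj2 (Nat.ltb_lt i n) Hi). exact Hqi. }
  pose proof (last_minimum_lower _ _ _ _ HWA) as Hlow.
  assert (HKs : INR (S n * (2 * S n * (A * s) + 1) ^ n) <= K * INR s ^ n).
  { unfold K. rewrite <- pow_INR, <- mult_INR. apply le_INR.
    rewrite <- (Nat.mul_assoc (S n)), <- Nat.pow_mul_l. apply Nat.mul_le_mono_l.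
    apply Nat.pow_le_mono_l. nia. }
  assert (Hsn : 0 < INR s ^ n) by (apply pow_lt; lra).
  pose proof (Rabs_pos (xi n alpha (W n))) as Hpos.
  assert (H1 : 1 <= K * INR s ^ n * Rabs (xi n alpha (W n))).
  { eapply Rle_trans; [exact Hlow|]. apply Rmult_le_compat_r; assumption. }
  assert (HKs0 : 0 < K * INR s ^ n) by (apply Rmult_lt_0_compat; assumption).
  apply Rle_ge. apply Rmult_le_reg_l with (K * INR s ^ n); [exact HKs0|].
  replace (K * INR s ^ n * (delta / K / INR s ^ n)) with delta by (field; lra).
  apply Rle_trans with (K * INR s ^ n * (delta * Rabs (xi n alpha (W n)))).
  - replace (K * INR s ^ n * (delta * Rabs (xi n alpha (W n)))) with
      (delta * (K * INR s ^ n * Rabs (xi n alpha (W n)))) by ring.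
    nra.
  - apply Rmult_le_compat_l; lra.
Qed.

Theorem theorem3 (n : nat) (alpha : nat -> R) (B : nat -> nat -> nat -> Z) :
  (1 <= n)%nat ->
  Q_lin_indep_with_1 n alpha ->
  minkowski_chain n alpha B ->
  (badly_approximable n alpha <->
   exists delta : R, 0 < delta /\
     forall k : nat, Rabs (alpha_k1 n alpha (B k)) >= delta).
Proof.
  intros Hn HQ HB. split.
  - intros Hba. destruct (badly_approximable_ratio n alpha Hn Hba) as (delta & Hd & H).
    exists delta. split; [exact Hd|]. intros k.
    destruct HB as (mk & _ & HA & Hnew).
    apply (alpha_k1_ge n (mk k)); [apply HA|].
    (* [Hnew] serves to obtain [1 <= mk k], which is part of [new_A]. *)
    apply (H (mk k)); [|apply HA]. apply Hnew. exists k. reflexivity.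
  (* The converse uses boxes of sizes outside the range of [mk], hence the covering lemma. *)
  - intros (delta & Hd & H). apply (ratio_badly_approximable n alpha delta Hd).
    intros m Hm. destruct (minkowski_chain_cover n m alpha B HQ HB Hm) as [k Hk].
    exists (B k). split; [exact Hk|]. apply (alpha_k1_ge n m); [exact Hk|apply H].
Qed.
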